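(* For every $r\ge1$, the boolean number of the Ferrers graph of the staircase shape $\sigma_r=(r,r-1,\ldots,2,1)$ is $$\beta(\sigma_r)=\sum_{j=1}^{r}\sum_{\ell=1}^{j}(-1)^{r+\ell}\,\frac{(2\ell+1)(\ell^2+\ell)^r\cdot j!\,j!}{(\ell+j+1)!\,(j-\ell)!}.$$
   Context: Boolean number: for a finite simple graph $G$, the integer $\beta(G)$ is the (well-defined, isomorphism-invariant) quantity determined recursively by $\beta(\emptyset)=1$ for the empty graph, $\beta(\delta_n)=0$ where $\delta_n$ ($n\ge1$) is the graph of $n$ isolated vertices, and, for any edge $e$ of $G$, $\beta(G)=\beta(G-e)+\beta(G/e)+\beta(G-[e])$. Here $G-e$ deletes the edge $e$; $G/e$ contracts $e$ and then removes loops and redundant (parallel) edges; $G-[e]$ removes $e$ together with both its end vertices (and all edges incident to them). It is known that the recursion is independent of choices, and that $\beta(G)$ is the number of spheres of dimension $|G|-1$ in the wedge of spheres to which the boolean complex of $G$ is homotopy equivalent (the boolean complex being the regular cell complex of the simplicial poset of words in distinct vertices of $G$, ordered by substring inclusion, modulo commuting letters that are non-adjacent in $G$). Ferrers graph: for a Ferrers shape $\lambda=(\lambda_1,\ldots,\lambda_r)$ (integers $\lambda_1\ge\cdots\ge\lambda_r\ge0$) the Ferrers graph has vertex set $\{x_1,\ldots,x_r\}\sqcup\{y_1,\ldots,y_{\lambda_1}\}$ and an edge $\{x_i,y_j\}$ exactly when $\lambda_i\ge j$; $\beta(\lambda)$ denotes its boolean number. *)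

(* Defs.v *)
From HB Require Import structures.
From mathcomp Require Import all_boot all_order all_algebra.

Set Implicit Arguments.
Unset Strict Implicit.
Unset Printing Implicit Defensive.

Import Order.TTheory GRing.Theory Num.Theory.

Record sgraph := SGraph {
  vertex :> finType;
  adj : rel vertex;
  adj_sym : symmetric adj;
  adj_irr : irreflexive adj }.

Arguments adj {s} x y.

Definition sgraph_iso (G H : sgraph) : Prop :=
  exists2 f : G -> H, bijective f & forall x y, adj (f x) (f y) = adj x y.

Section Operations.
Variables (G : sgraph) (u v : G).

Definition del_edge_rel : rel G :=
  fun x y => adj x y && ((x, y) != (u, v)) && ((x, y) != (v, u)).

Fact del_edge_sym : symmetric del_edge_rel.
Proof.
move=> x y; rewrite /del_edge_rel adj_sym !xpair_eqE -!andbA; congr (_ && _).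
by rewrite [LHS]andbC [(x == v) && _]andbC [(x == u) && _]andbC.
Qed.

Fact del_edge_irr : irreflexive del_edge_rel.
Proof. by move=> x; rewrite /del_edge_rel adj_irr. Qed.

Definition del_edge : sgraph := SGraph del_edge_sym del_edge_irr.

(* The end vertex v is identified with u: u represents the merged vertex, and
   the remaining vertices are those of G other than v. *)
Definition contract_rel : rel {x : G | x != v} :=
  fun x y => (x != y) &&
    [|| adj (val x) (val y),
        (val x == u) && adj v (val y) | (val y == u) && adj (val x) v].

Fact contract_sym : symmetric contract_rel.
Proof.
move=> x y; rewrite /contract_rel eq_sym [adj (val x) (val y)]adj_sym.
rewrite [adj v (val y)]adj_sym [adj v (val x)]adj_sym.
by congr (_ && (_ || _)); rewrite orbC.
Qed.

Fact contract_irr : irreflexive contract_rel.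
Proof. by move=> x; rewrite /contract_rel eqxx. Qed.

Definition contract : sgraph := SGraph contract_sym contract_irr.

Definition del_ends_rel : rel {x : G | (x != u) && (x != v)} :=
  fun x y => adj (val x) (val y).

Fact del_ends_sym : symmetric del_ends_rel.
Proof. by move=> x y; apply: adj_sym. Qed.

Fact del_ends_irr : irreflexive del_ends_rel.
Proof. by move=> x; apply: adj_irr. Qed.

Definition del_ends : sgraph := SGraph del_ends_sym del_ends_irr.

End Operations.

(* Ordered pairs of adjacent vertices: each edge is counted twice. *)
Definition arcs (G : sgraph) : {set G * G} := [set p : G * G | adj p.1 p.2].

(* All three operations on an edge strictly decrease #|arcs G|, which is hence
   enough fuel; the value does not depend on the edges that are picked (see
   boolean_number_edge and boolean_number_iso below). *)
Fixpoint boolean_number_rec (n : nat) (G : sgraph) : nat :=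
  match n, [pick p in arcs G] with
  | n'.+1, Some (u, v) =>
      boolean_number_rec n' (del_edge u v)
      + boolean_number_rec n' (contract u v)
      + boolean_number_rec n' (del_ends u v)
  | _, _ => #|G| == 0
  end.

Definition boolean_number (G : sgraph) : nat :=
  boolean_number_rec #|arcs G| G.

Section Ferrers.
Variable s : seq nat.

(* x_i is inl (i-1) and y_j is inr (j-1). *)
Definition ferrers_rel : rel ('I_(size s) + 'I_(nth 0 s 0)) :=
  fun a b => match a, b with
  | inl i, inr j | inr j, inl i => j < nth 0 s i
  | _, _ => false
  end.

Fact ferrers_sym : symmetric ferrers_rel.
Proof. by case=> [i|j] [i'|j']. Qed.

Fact ferrers_irr : irreflexive ferrers_rel.
Proof. by case. Qed.

Definition ferrers : sgraph := SGraph ferrers_sym ferrers_irr.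

End Ferrers.

Definition is_ferrers_shape (s : seq nat) : bool := sorted geq s.

Definition staircase (r : nat) : seq nat := rev (iota 1 r).

Lemma staircase_shape r : is_ferrers_shape (staircase r).
Proof. by rewrite /is_ferrers_shape rev_sorted iota_sorted. Qed.

(* The rest shows that boolean_number satisfies the defining recursion for
   every edge and is isomorphism invariant. Up to sign it is the value at -1 of
   the polynomial counting the colourings of some of the vertices of G with k
   colours in which adjacent coloured vertices have distinct colours. *)

Lemma card_bij_on (T T' : finType) (A : {set T}) (B : {set T'})
    (f : T -> T') (g : T' -> T) :
  {in A, forall x, f x \in B} -> {in B, forall y, g y \in A} ->
  {in A, cancel f g} -> {in B, cancel g f} -> #|A| = #|B|.
Proof.
move=> fA gB fK gK; apply/eqP; rewrite eqn_leq; apply/andP; split.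
  rewrite -(card_in_imset (can_in_inj fK)); apply/subset_leq_card/subsetP.
  by move=> _ /imsetP[x /fA ? ->].
rewrite -(card_in_imset (can_in_inj gK)); apply/subset_leq_card/subsetP.
by move=> _ /imsetP[x /gB ? ->].
Qed.

Section PartialColourings.
Variable k : nat.

Definition pcol (G : sgraph) (f : G -> option 'I_k) : bool :=
  [forall x, forall y, adj x y ==> (f x == f y) ==> (f x == None)].

Definition pcols (G : sgraph) : {set {ffun G -> option 'I_k}} :=
  [set f : {ffun G -> option 'I_k} | pcol f].

Lemma pcolP (G : sgraph) (f : G -> option 'I_k) :
  reflect (forall x y, adj x y -> f x = f y -> f x = None) (pcol f).
Proof.
apply: (iffP forallP) => [H x y xy fxy | H x].
  by have /forallP/(_ y) := H x; rewrite xy fxy eqxx => /eqP.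
apply/forallP=> y; apply/implyP=> xy; apply/implyP=> /eqP fxy.
by apply/eqP/(H x y).
Qed.

Lemma card_pcols_edgeless G :
  arcs G = set0 -> #|pcols G| = k.+1 ^ #|G|.
Proof.
move=> G0; have -> : pcols G = [set: {ffun G -> option 'I_k}].
  apply/setP=> f; rewrite !inE; apply/pcolP => x y xy.
  by have := in_set0 (x, y); rewrite -G0 inE xy.
by rewrite cardsT card_ffun card_option card_ord.
Qed.

Lemma card_pcols_iso G H : sgraph_iso G H -> #|pcols G| = #|pcols H|.
Proof.
case=> f [g fK gK] fadj.
apply: (card_bij_on (f := fun c : {ffun G -> option 'I_k} => [ffun y => c (g y)])
                    (g := fun c : {ffun H -> option 'I_k} => [ffun x => c (f x)])).
- move=> c; rewrite !inE => /pcolP cP; apply/pcolP=> x y xy.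
  by rewrite !ffunE; apply: cP; rewrite -fadj !gK.
- move=> c; rewrite !inE => /pcolP cP; apply/pcolP=> x y xy.
  by rewrite !ffunE; apply: cP; rewrite fadj.
- by move=> c _; apply/ffunP=> x; rewrite !ffunE fK.
- by move=> c _; apply/ffunP=> x; rewrite !ffunE gK.
Qed.

Section Edge.
Variables (G : sgraph) (u v : G).
Hypothesis uv : adj u v.

Let uNv : u != v.
Proof. by apply: contraTneq uv => ->; rewrite adj_irr. Qed.

Let u' : contract u v := Sub u uNv.

Let mono : {set {ffun G -> option 'I_k}} :=
  [set f in pcols (del_edge u v) | (f u == f v) && (f u != None)].

Lemma card_pcols_del_edge : #|pcols (del_edge u v)| = #|pcols G| + #|mono|.
Proof.
rewrite -(cardsID mono (pcols (del_edge u v))) addnC; congr (_ + _).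
  apply: eq_card => f; rewrite !inE; apply/andP/pcolP.
    case=> nm /pcolP fP x y xy fxy.
    case: (boolP (adj (x : del_edge u v) y)) => [/fP->//|].
    rewrite /= /del_edge_rel xy /= negb_and !negbK !xpair_eqE.
    move: nm; rewrite negb_and negb_and negbK.
    have -> : pcol (G := del_edge u v) f by apply/pcolP.
    move=> /= nm /orP[]/andP[/eqP ? /eqP ?]; subst x y; move: nm.
      by rewrite fxy eqxx => /eqP.
    by rewrite fxy eqxx => /eqP.
  move=> fP; have fdP : pcol (G := del_edge u v) f.
    by apply/pcolP => x y /andP[/andP[xy _] _]; apply: fP.
  split=> //; rewrite fdP /= negb_and negbK.
  by case: eqP => //= /(fP _ _ uv) ->.
by apply: eq_card => f; rewrite !inE andbA andbb.
Qed.

Let vmerge (x : G) : contract u v := insubd u' x.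

Let vmergeE x : val (vmerge x) = if x == v then u else x.
Proof. by rewrite /vmerge val_insubd; case: eqP. Qed.

Let vmergeK (x : contract u v) : vmerge (val x) = x.
Proof. by rewrite /vmerge valKd. Qed.

Lemma card_mono :
  #|mono| = #|[set f in pcols (contract u v) | f u' != None]|.
Proof.
apply: (card_bij_on
  (f := fun c : {ffun G -> option 'I_k} =>
          [ffun x : contract u v => c (val x)])
  (g := fun c : {ffun contract u v -> option 'I_k} => [ffun x => c (vmerge x)])).
- move=> c; rewrite !inE => /andP[/pcolP cP /andP[/eqP cuv cu]].
  rewrite ffunE cu andbT; apply/pcolP => x y xy.
  rewrite !ffunE.
  have nv (z : contract u v) : (val z == v) = false by apply/negbTE/(valP z).
  have cP1 (a b : G) : adj a b -> (a, b) != (u, v) -> (a, b) != (v, u) ->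
      c a = c b -> c a = None.
    by move=> ab h1 h2; apply: cP; rewrite /= /del_edge_rel ab h1 h2.
  case/andP: xy => xNy /or3P[xy|/andP[/eqP xu vy]|/andP[/eqP yu xv]] cxy.
  + by apply: (cP1 _ _ xy) cxy; rewrite xpair_eqE ?nv ?andbF.
  + rewrite xu cuv; apply: (cP1 _ _ vy).
    * by rewrite xpair_eqE nv andbF.
    * rewrite xpair_eqE eqxx /=; apply: contraNneq xNy => yu.
      by apply/eqP/val_inj; exact: etrans xu (esym yu).
    * by rewrite -cuv -cxy xu.
  + apply: (cP1 _ _ xv).
    * rewrite xpair_eqE eqxx andbT; apply: contraNneq xNy => xu.
      by apply/eqP/val_inj; exact: etrans xu (esym yu).
    * by rewrite xpair_eqE nv.
    * by rewrite cxy yu cuv.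
- move=> c; rewrite !inE => /andP[/pcolP cP cu].
  have mu : vmerge u = u' by rewrite -[u]/(val u') vmergeK.
  have mv : vmerge v = u' by apply: val_inj; rewrite vmergeE eqxx.
  rewrite !ffunE mu mv eqxx cu !andbT; apply/pcolP => x y.
  case/andP=> /andP[xy n1] n2; rewrite !ffunE; apply: cP.
  have xNy : x != y by apply: contraTneq xy => ->; rewrite adj_irr.
  rewrite /= /contract_rel -val_eqE /= !vmergeE.
  move: n1 n2; rewrite !xpair_eqE.
  case: (eqVneq x v) => [xv|xv]; case: (eqVneq y v) => [yv|yv].
  + by rewrite xv yv eqxx in xNy.
  + rewrite -xv xy eqxx !orbT andbT => _ /=; by rewrite eq_sym.
  + by rewrite -yv xy eqxx !orbT !andbT.
  + by rewrite xNy xy.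
- move=> c; rewrite !inE => /andP[_ /andP[/eqP cuv _]].
  apply/ffunP=> x; rewrite !ffunE vmergeE.
  by case: eqP => [->|].
- by move=> c _; apply/ffunP=> x; rewrite !ffunE vmergeK.
Qed.

Let udrop (x : del_ends u v) : contract u v := vmerge (val x).

Let udropE x : val (udrop x) = val x.
Proof. by rewrite vmergeE; case/andP: (valP x) => _ /negbTE->. Qed.

Lemma card_pcols_del_ends :
  #|pcols (del_ends u v)| = #|[set f in pcols (contract u v) | f u' == None]|.
Proof.
apply: (card_bij_on
  (g := fun c : {ffun contract u v -> option 'I_k} => [ffun x => c (udrop x)])
  (f := fun c : {ffun del_ends u v -> option 'I_k} =>
          [ffun x : contract u v =>
             if insub (val x) is Some y then c y else None])).
- move=> c; rewrite !inE => /pcolP cP; apply/andP; split; last first.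
    by rewrite ffunE insubF //= eqxx.
  apply/pcolP=> x y xy; rewrite !ffunE.
  case: insubP => //= a; case/andP => xu xv ea.
  case: insubP => //= b; case/andP => yu yv eb.
  apply: cP; case/andP: xy => _; rewrite (negbTE xu) (negbTE yu) /= orbF => xy.
  by apply: etrans xy; congr adj.
- move=> c; rewrite !inE => /andP[/pcolP cP _].
  apply/pcolP=> x y xy; rewrite !ffunE; apply: cP.
  rewrite /= /contract_rel -val_eqE /= !udropE; apply/andP; split.
    by apply: contraTneq xy => /val_inj ->; rewrite adj_irr.
  by apply/orP; left; apply: xy.
- move=> c _; apply/ffunP=> x; rewrite !ffunE udropE valK //.
- move=> c; rewrite !inE => /andP[_ /eqP cu]; apply/ffunP=> x; rewrite ffunE.
  case: insubP => [a _ ea|]; first by rewrite ffunE; congr (c _); apply/val_inj; rewrite udropE.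
  rewrite negb_and !negbK (negbTE (valP x)) orbF => /eqP xu.
  by rewrite -cu; congr (c _); apply/val_inj.
Qed.

Lemma card_pcols_edge :
  #|pcols G| + #|pcols (contract u v)| =
  #|pcols (del_edge u v)| + #|pcols (del_ends u v)|.
Proof.
rewrite card_pcols_del_edge card_mono card_pcols_del_ends -addnA; congr (_ + _).
rewrite -(cardsID [set f : {ffun contract u v -> option 'I_k} | f u' != None]).
by congr (_ + _); apply: eq_card => f; rewrite !inE ?negbK // andbC.
Qed.

End Edge.
End PartialColourings.

Section Arcs.
Variables (G : sgraph) (u v : G).
Hypothesis uv : adj u v.

Lemma card_contract : #|contract u v|.+1 = #|G|.
Proof. by rewrite card_sig (cardC1 v) prednK //; apply/card_gt0P; exists u. Qed.

Lemma card_del_ends : #|del_ends u v|.+2 = #|G|.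
Proof.
have uNv : u != v by apply: contraTneq uv => ->; rewrite adj_irr.
rewrite card_sig -(cardC (pred2 u v)) card2 uNv add2n; congr _.+2.
by apply: eq_card => x; rewrite !inE negb_or.
Qed.

Lemma arcs_del_edge : #|arcs (del_edge u v)| < #|arcs G|.
Proof.
apply/proper_card/properP; split.
  by apply/subsetP=> p; rewrite !inE => /andP[/andP[]].
by exists (u, v); rewrite ?inE //= /del_edge_rel eqxx andbF.
Qed.

Lemma arcs_contract : #|arcs (contract u v)| < #|arcs G|.
Proof.
have uNv : u != v by apply: contraTneq uv => ->; rewrite adj_irr.
pose m x : contract u v := insubd (Sub u uNv : contract u v) x.
have mv : m v = Sub u uNv by apply: val_inj; rewrite val_insubd eqxx.
have mK (x : contract u v) : m (val x) = x by rewrite /m valKd.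
rewrite [ltnRHS](cardsD1 (u, v)) inE uv add1n ltnS.
apply: leq_trans (leq_imset_card (fun p => (m p.1, m p.2)) _).
apply/subset_leq_card/subsetP=> -[x y]; rewrite inE /= => xy.
have nv (z : contract u v) : (val z == v) = false by apply/negbTE/(valP z).
case/andP: xy => xNy /or3P[xy|/andP[/eqP xu vy]|/andP[/eqP yu xv]].
- apply/imsetP; exists (val x, val y); rewrite ?mK //.
  by rewrite !inE xy andbT xpair_eqE nv andbF.
- apply/imsetP; exists (v, val y); rewrite ?mK ?mv.
    by rewrite !inE vy andbT xpair_eqE nv andbF.
  by congr (_, _); apply: val_inj.
- apply/imsetP; exists (val x, v); rewrite ?mK ?mv.
    rewrite !inE xv andbT xpair_eqE eqxx andbT; apply: contraNneq xNy => xu.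
    by apply/eqP/val_inj; exact: etrans xu (esym yu).
  by congr (_, _); apply: val_inj.
Qed.

Lemma arcs_del_ends : #|arcs (del_ends u v)| < #|arcs G|.
Proof.
rewrite [ltnRHS](cardsD1 (u, v)) inE uv add1n ltnS.
have i : injective (fun p : del_ends u v * del_ends u v => (val p.1, val p.2)).
  by case=> a b [c d] [/val_inj-> /val_inj->].
rewrite -(card_imset _ i); apply/subset_leq_card/subsetP=> _ /imsetP[[x y] xy ->].
move: xy; rewrite !inE /= => xy; rewrite [adj _ _]xy andbT xpair_eqE.
by case/andP: (valP x) => /negbTE->.
Qed.

End Arcs.

Local Open Scope ring_scope.

Fixpoint pcol_poly (n : nat) (G : sgraph) : {poly int} :=
  match n, [pick p in arcs G] with
  | n'.+1, Some (u, v) =>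
      pcol_poly n' (del_edge u v) - pcol_poly n' (contract u v)
      + pcol_poly n' (del_ends u v)
  | _, _ => ('X + 1) ^+ #|G|
  end.

Lemma arcs_pick_none G : [pick p in arcs G] = None -> arcs G = set0.
Proof. by case: pickP => // G0 _; apply/setP=> p; rewrite G0 inE. Qed.

Lemma pcol_polyP n G k : (#|arcs G| <= n)%N ->
  (pcol_poly n G).[k%:R] = #|pcols k G|%:R.
Proof.
have base H : arcs H = set0 ->
    (('X + 1) ^+ #|H|).[k%:R] = #|pcols k H|%:R :> int.
  by move=> H0; rewrite (card_pcols_edgeless _ H0) !hornerE natrX -addn1 natrD.
elim: n G => [|n IH] G; first by rewrite leqn0 cards_eq0 => /eqP/base.
move=> /= le; case e: [pick p in arcs G] => [[u v]|]; last first.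
  by rewrite base // arcs_pick_none.
have uv : adj u v.
  by move: e; case: pickP => // p pG [] ep; move: pG; rewrite ep inE.
have lt m : (m < #|arcs G|)%N -> (m <= n)%N.
  by move=> ltm; rewrite -ltnS (leq_trans ltm).
rewrite !hornerE !IH; last exact/lt/arcs_del_edge.
- rewrite addrAC -natrD -card_pcols_edge // natrD addrK //.
- exact/lt/arcs_contract.
- exact/lt/arcs_del_ends.
Qed.

Lemma poly_int_eq (p q : {poly int}) :
  (forall k : nat, p.[k%:R] = q.[k%:R]) -> p = q.
Proof.
move=> pq; apply/eqP; rewrite -subr_eq0; apply/negPn/negP => nz.
pose rs : seq int := [seq k%:R | k <- iota 0 (size (p - q))].
have := @max_poly_roots _ (p - q) rs nz; rewrite size_map size_iota ltnn => h.
suff : false by []; apply: h.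
  by apply/allP=> _ /mapP[k _ ->]; rewrite /root !hornerE pq subrr.
by rewrite map_inj_uniq ?iota_uniq // => a b /eqP; rewrite eqr_nat => /eqP.
Qed.

Lemma boolean_number_recE n G :
  (boolean_number_rec n G)%:R = (-1) ^+ #|G| * (pcol_poly n G).[-1] :> int.
Proof.
have base H : (#|vertex H| == 0%N)%:R
    = (-1) ^+ #|H| * (('X + 1) ^+ #|H|).[-1] :> int.
  by rewrite !hornerE addNr expr0n; case: eqP => [->|_]; rewrite ?mulr0 ?mulr1.
elim: n G => [|n IH] G; first exact: base.
move=> /=; case e: [pick p in arcs G] => [[u v]|]; last exact: base.
have uv : adj u v.
  by move: e; case: pickP => // p pG [] ep; move: pG; rewrite ep inE.
rewrite !natrD !IH !hornerE !mulrDr; congr (_ + _ + _).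
- by rewrite -(card_contract u v) exprS mulN1r mulrNN.
- by rewrite -(card_del_ends uv) !exprS !mulN1r opprK.
Qed.

Lemma boolean_number_edge (G : sgraph) (u v : G) : adj u v ->
  boolean_number G = (boolean_number (del_edge u v)
    + boolean_number (contract u v) + boolean_number (del_ends u v))%N.
Proof.
move=> uv; apply/eqP; rewrite -(eqr_nat int); apply/eqP.
rewrite !natrD !boolean_number_recE.
pose p H := pcol_poly #|arcs H| H.
have -> : pcol_poly #|arcs G| G
    = p (del_edge u v) - p (contract u v) + p (del_ends u v).
  apply: poly_int_eq => k; rewrite !hornerE !pcol_polyP //.
  by rewrite addrAC -natrD -card_pcols_edge // natrD addrK.
rewrite !hornerE !mulrDr; congr (_ + _ + _).
- by rewrite -(card_contract u v) exprS mulN1r mulrNN.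
- by rewrite -(card_del_ends uv) !exprS !mulN1r opprK.
Qed.

Lemma boolean_number_iso G H :
  sgraph_iso G H -> boolean_number G = boolean_number H.
Proof.
move=> GH; apply/eqP; rewrite -(eqr_nat int); apply/eqP.
rewrite !boolean_number_recE; have -> : #|G| = #|H|.
  by case: GH => f /bij_eq_card.
congr (_ * _.[_]); apply: poly_int_eq => k.
by rewrite !pcol_polyP // (card_pcols_iso _ GH).
Qed.

Lemma boolean_number_edgeless (G : sgraph) :
  (forall x y : G, ~~ adj x y) -> boolean_number G = (#|G| == 0%N).
Proof.
move=> G0; rewrite /boolean_number.
have -> : arcs G = set0 by apply/setP=> p; rewrite !inE (negbTE (G0 _ _)).
by rewrite cards0.
Qed.

(* Main.v *)
Require Import Defs.
From HB Require Import structures.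
From mathcomp Require Import all_boot all_order all_algebra.
From mathcomp Require Import ring zify.

(** The boolean number of a graph G is, up to the sign (-1)^|G|, the value at
    k = -1 of the polynomial counting the partial proper colourings of G with
    k colours; so it suffices to count the partial colourings of the staircase
    graph for every k and to evaluate at k = -1.

    The neighbourhoods in a Ferrers graph are nested: y_j is joined to an
    initial segment of the x_i. Once a colouring of the x_i is chosen, the y_j
    are therefore coloured independently, and the number of ways depends only
    on the numbers of colours used on the initial segments
    (card_pcols_ferrers). For the staircase each initial segment of the x_i
    occurs exactly once. Colouring x_1, x_2, ... in turn and remembering only
    how many colours have appeared gives a two-term recursion, whose solution
    is prefix_weight (sum_prod_prefixes). With s colours used so far, the next
    x repeats a colour or stays uncoloured in s + 1 ways and introduces a new
    one in k - s ways; the y attached to the segment then has k - s' + 1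
    options, where s' is the new number of used colours. At k = -1 this weighs
    the step s -> s by -s(s+1) and the step s -> s+1 by (s+1)^2
    (boolean_number_staircase).

    On the other side, up to sign and a factor (j!)^2, the inner sum of the
    formula is the closed form of a Legendre-Stirling number of the second kind
    with indices r and j. Hence it is the total weight of the r-step walks from
    0 to j for these very weights (staircase_coefSS); summing over j counts all
    walks of length r, which is what the colourings gave
    (staircase_coef_prefix_weight). *)

Import Order.TTheory GRing.Theory Num.Theory.

Local Open Scope ring_scope.

(** * Partial colourings of Ferrers graphs *)

(** The entry of the conjugate partition of s at j is count (ltn j) s; the
    lemma is the symmetry of the diagram of s under transposition. *)
Lemma count_ltn_sorted_geq (s : seq nat) (j i : nat) :
  is_ferrers_shape s -> (i < count (ltn j) s)%N = (j < nth 0%N s i)%N.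
Proof.
rewrite /is_ferrers_shape.
elim: s i => [|a s IH] i; first by rewrite nth_nil.
rewrite /= path_sortedE; last by move=> x y z yx zy; apply: leq_trans zy yx.
case/andP=> /allP sa /IH{}IH.
case: (ltnP j a) => ja; first by case: i => [|i] //=; rewrite add1n ltnS IH.
have s0 : count (ltn j) s = 0%N.
  apply/eqP; rewrite -leqn0 leqNgt -has_count; apply/hasPn => x /sa /= xa.
  by rewrite -leqNgt (leq_trans xa ja).
rewrite s0 addn0 ltn0; case: i => [|i] /=; apply/esym/negbTE.
  by rewrite -leqNgt.
by rewrite -leqNgt leqNgt -IH s0.
Qed.

Lemma mem_take_tuple (T : eqType) (n m : nat) (t : n.-tuple T) (c : T) :
  reflect (exists2 i : 'I_n, (i < m)%N & tnth t i = c) (c \in take m t).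
Proof.
apply: (iffP idP) => [ct | [i im <-]].
  have := ct; rewrite -index_mem size_take_min size_tuple leq_min => /andP[im iN].
  exists (Ordinal iN) => //=.
  by rewrite (tnth_nth c) /= -(nth_take c im) nth_index.
rewrite (tnth_nth (tnth t i)) -(nth_take _ im) mem_nth //.
by rewrite size_take_min size_tuple leq_min im ltn_ord.
Qed.

(** For a fixed colouring t of the rows, column j may stay uncoloured (whence
    the successor) or take any colour absent from the rows that it meets, and
    these choices are independent. Having None in the set that is complemented
    makes it count as a colour already in use. *)
Lemma card_pcols_ferrers (k : nat) (s : seq nat) : is_ferrers_shape s ->
  #|pcols k (ferrers s)| =
    (\sum_(t : (size s).-tuple (option 'I_k)) \prod_(j < nth 0 s 0)
       (#|~: [set c in None :: take (count (ltn j) s) t]|).+1)%N.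
Proof.
move=> sF; set T := option 'I_k.
pose F (t : (size s).-tuple T) (j : 'I_(nth 0%N s 0)) : {set T} :=
  None |: ~: [set c in None :: take (count (ltn j) s) t].
pose B := [set p : (size s).-tuple T * {ffun 'I_(nth 0%N s 0) -> T}
             | p.2 \in family (F p.1)].
transitivity #|B|.
  apply: (card_bij_on
    (f := fun c : {ffun ferrers s -> T} =>
            ([tuple c (inl i) | i < size s], [ffun j => c (inr j)]))
    (g := fun p : (size s).-tuple T * {ffun 'I_(nth 0%N s 0) -> T} =>
            [ffun v : ferrers s =>
               match v with inl i => tnth p.1 i | inr j => p.2 j end])).
  - move=> c; rewrite !inE => /pcolP cP; apply/familyP => j.
    rewrite ffunE !inE; case: eqP => // cj; apply/negP.
    case/mem_take_tuple => i; rewrite (count_ltn_sorted_geq _ _ _ sF) => ij.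
    rewrite tnth_mktuple => cij; apply: cj.
    by apply: (cP (inr j) (inl i)).
  - case=> t g; rewrite !inE /= => /familyP gP.
    (* both orientations of an edge reduce to this one *)
    have tg (i : 'I_(size s)) (j : 'I_(nth 0%N s 0)) :
        (j < nth 0 s i)%N -> tnth t i = g j -> g j = None.
      move=> ij tg; have := gP j; rewrite !inE; case: eqP => //= _ /negP[].
      apply/mem_take_tuple; exists i => //.
      by rewrite (count_ltn_sorted_geq _ _ _ sF).
    apply/pcolP=> -[i|j] [i'|j'] //= ij; rewrite !ffunE => e.
      by rewrite e; apply: tg ij e.
    by apply: tg ij (esym e).
  - by move=> c _; apply/ffunP=> -[i|j]; rewrite !ffunE ?tnth_mktuple ?ffunE.
  - case=> t g _; congr (_, _).
      by apply: eq_from_tnth => i; rewrite tnth_mktuple ffunE.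
    by apply/ffunP=> j; rewrite !ffunE.
rewrite -sum1_card (eq_bigl (fun p => xpredT p.1 && (p.2 \in family (F p.1))));
  last by move=> p; rewrite inE.
rewrite -(pair_big_dep xpredT (fun t g => g \in family (F t)) (fun _ _ => 1%N)).
apply: eq_bigr => t _ /=.
rewrite sum1_card card_family foldrE big_map big_enum; apply: eq_bigr => j _ /=.
by rewrite cardsU1 !inE eqxx.
Qed.

(** * Counting colourings by the number of colours in use *)

(** Total weight of the words of n letters from an alphabet of q letters, u of
    which are in use at the start. A letter of the word is either in use (u
    choices) or new (q - u choices), and is weighted by one plus the number of
    letters unused after it. The size q is a ring element so that it can be
    specialised outside the natural numbers. *)
Fixpoint prefix_weight {R : pzRingType} (q : R) (n u : nat) : R :=
  if n is n'.+1 then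
    u%:R * (q + 1 - u%:R) * prefix_weight q n' u
    + (q - u%:R) ^+ 2 * prefix_weight q n' u.+1
  else 1.

Lemma rmorph_prefix_weight (R S : pzRingType) (f : {rmorphism R -> S})
    (q : R) (n u : nat) :
  f (prefix_weight q n u) = prefix_weight (f q) n u.
Proof.
elim: n u => [|n IH] u /=; first exact: rmorph1.
by rewrite !(rmorphD, rmorphN, rmorphM, rmorphXn, rmorph1, rmorph_nat) /= !IH.
Qed.

(** Splitting off the first letter adds it to the initial set U, and only the
    cardinal of the new set matters. *)
Lemma sum_prod_prefixes (T : finType) (n : nat) (U : {set T}) :
  \sum_(t : n.-tuple T) \prod_(m < n)
     ((#|~: (U :|: [set c in take m.+1 t])|).+1)%:R
  = prefix_weight #|T|%:R n #|U| :> int.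
Proof.
elim: n U => [|n IH] U /=.
  rewrite (big_pred1 [tuple]) ?big_ord0 // => t.
  by rewrite (tuple0 t); apply/esym/eqP.
pose step c : int := (#|~: (c |: U)|).+1%:R * prefix_weight #|T|%:R n #|c |: U|.
transitivity (\sum_c step c).
  rewrite (reindex (fun p : T * n.-tuple T => [tuple of p.1 :: p.2])) /=; last first.
    exists (fun t => (thead t, [tuple of behead t])) => [[c t] _|t _] /=.
      by congr (_, _); apply: val_inj.
    by rewrite [RHS]tuple_eta.
  rewrite -(pair_bigA _ (fun c (t : n.-tuple T) => \prod_(m < n.+1)
     ((#|~: (U :|: [set x in take m.+1 (c :: t)])|).+1)%:R)) /=.
  apply: eq_bigr => c _; rewrite /step -IH mulr_sumr; apply: eq_bigr => t _.
  rewrite big_ord_recl /= take0; congr (#|~: _|.+1%:R * _).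
    by apply/setP=> x; rewrite !inE orbC.
  apply: eq_bigr => m _; congr (#|~: _|.+1%:R).
  by apply/setP=> x; rewrite !inE /= orbCA orbA.
have cC (A : {set T}) : #|~: A|%:R = #|T|%:R - #|A|%:R :> int.
  by rewrite -(cardsC A) natrD addrAC subrr add0r.
rewrite (bigID (mem U)) /=; congr (_ + _).
  rewrite (eq_bigr (fun _ =>
    (#|T|%:R + 1 - #|U|%:R) * prefix_weight #|T|%:R n #|U|)).
    by rewrite sumr_const -[LHS]mulr_natl mulrA.
  move=> c cU; rewrite /step (setUidPr _) ?sub1set // -addn1 natrD cC.
  by rewrite addrAC.
rewrite (eq_bigr (fun _ =>
  (#|T|%:R - #|U|%:R) * prefix_weight #|T|%:R n #|U|.+1)).
  rewrite (eq_bigl (mem (~: U))) => [|c]; last by rewrite !inE.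
  by rewrite sumr_const -[LHS]mulr_natl cC mulrA expr2.
move=> c cU; rewrite /step -addn1 natrD cC cardsU1 cU add1n; congr (_ * _).
by rewrite -addn1 natrD; ring.
Qed.

(** Here the letters are the k colours together with None, which is in use from
    the start; this is why q = k + 1 and u = 1. *)
Lemma card_pcols_staircase (k r : nat) :
  #|pcols k (ferrers (staircase r))|%:R = prefix_weight k.+1%:R r 1 :> int.
Proof.
have size_r : size (staircase r) = r by rewrite size_rev size_iota.
rewrite card_pcols_ferrers ?staircase_shape //.
have count_r j : count (ltn j) (staircase r) = (r - j)%N.
  rewrite /staircase count_rev; elim: r {size_r} => // r IH.
  rewrite -(addn1 r) iotaD count_cat IH /= add1n; lia.
have head_r : nth 0%N (staircase r) 0 = r.
  by case: r {size_r count_r} => // r; rewrite nth_rev size_iota // nth_iota //; lia.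
rewrite size_r head_r natr_sum.
have -> : k.+1%:R = #|{: option 'I_k}|%:R :> int by rewrite card_option card_ord.
have := sum_prod_prefixes (option 'I_k) r [set None]; rewrite cards1 => <-.
(* column j meets the first r - j rows: reversed, the columns run through the
   prefixes by increasing length *)
apply: eq_bigr => t _; rewrite natr_prod (reindex_inj rev_ord_inj) /=.
apply: eq_bigr => m _; rewrite count_r subKn //.
by congr (#|~: _|.+1%:R); apply/setP=> c; rewrite !inE.
Qed.

(** Evaluating the number of colours at -1 makes the alphabet empty: q = 0. The
    sign is trivial because the graph has 2r vertices. *)
Lemma boolean_number_staircase (r : nat) :
  (boolean_number (ferrers (staircase r)))%:R = prefix_weight 0 r 1 :> int.
Proof.
rewrite boolean_number_recE; set G := ferrers _.
have -> : pcol_poly #|arcs G| G = prefix_weight ('X + 1) r 1.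
  apply: poly_int_eq => k; rewrite pcol_polyP // card_pcols_staircase.
  rewrite -[RHS]/(horner_eval k%:R _) rmorph_prefix_weight /=.
  by rewrite /horner_eval !hornerE -natr1.
rewrite -[_.[-1]]/(horner_eval (-1) _) rmorph_prefix_weight /=.
have -> : #|G| = (r + r)%N.
  rewrite card_sum !card_ord size_rev size_iota; congr addn.
  by case: r {G} => // r; rewrite nth_rev size_iota // nth_iota //; lia.
by rewrite addnn -mul2n exprM sqrrN !expr1n mul1r /horner_eval !hornerE addNr.
Qed.

(** * The closed formula as a count of walks *)

Lemma natr_fact_neq0 (n : nat) : n`!%:R != 0 :> rat.
Proof. by rewrite pnatr_eq0 -lt0n fact_gt0. Qed.

Definition staircase_term (n j l : nat) : rat :=
  (-1) ^+ (n + l) *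
  (((2 * l + 1) * (l ^ 2 + l) ^ n * j`! * j`!)%N%:R /
   ((l + j + 1)`! * (j - l)`!)%N%:R).

(** The sum starts at l = 0, although the formula starts at l = 1: the extra
    term vanishes for n > 0, and for n = 0 it makes the value correct, so that
    the recursion on n can be started at n = 0. *)
Definition staircase_coef (n j : nat) : rat :=
  \sum_(l < j.+1) staircase_term n j l.

Lemma staircase_term_l0 (n j : nat) : staircase_term n.+1 j 0 = 0.
Proof.
rewrite /staircase_term -[(0 ^ 2 + 0)%N]/0%N exp0n //.
by rewrite muln0 !mul0n mul0r mulr0.
Qed.

(** A telescoping sum: with J = j + 1, the term of index l is v_l - v_(l+1) for
    v_l = (-1)^l (l / J) J!^2 / ((l + J)! (J - l)!), and v_0 = 0. *)
Lemma staircase_term_base (j m : nat) : (m <= j.+1)%N ->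
  \sum_(l < m) staircase_term 0 j.+1 l =
    (-1) ^+ m.+1 * m%:R * (j`! * j.+1`!)%N%:R /
    ((m + j.+1)`! * (j.+1 - m)`!)%N%:R.
Proof.
elim: m => [|m IH] mj; first by rewrite big_ord0 mulr0 !mul0r.
rewrite big_ord_recr /= IH 1?ltnW // /staircase_term.
have [d ->] : exists d, j = (m + d)%N by exists (j - m)%N; lia.
have -> : ((m + d).+1 - m = d.+1)%N by lia.
have -> : ((m + d).+1 - m.+1 = d)%N by lia.
have -> : (m + (m + d).+1 + 1 = (m + (m + d).+1).+1)%N by lia.
have -> : (m.+1 + (m + d).+1 = (m + (m + d).+1).+1)%N by lia.
rewrite !factS expn0 add0n !exprS.
rewrite !natrM ?natrD -!natr1 ?natrD -?natr1 ?natrM.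
field.
by rewrite !natr_fact_neq0 ?(natr1, =^~ natrD) !pnatr_eq0.
Qed.

Lemma staircase_coef0 (j : nat) : staircase_coef 0 j = (j == 0)%:R.
Proof.
case: j => [|j].
  by rewrite /staircase_coef big_ord_recl big_ord0 addr0.
rewrite /staircase_coef big_ord_recr /= staircase_term_base // /staircase_term.
rewrite !subnn !addn1 fact0 add0n expn0 [(j.+1 + j.+1).+1`!]factS.
have := natr_fact_neq0 (j.+1 + j.+1); move: ((j.+1 + j.+1)`!) => c c0.
rewrite factS.
have -> : ((j.+1 + j.+1).+1 = (2 * j.+1).+1)%N by lia.
rewrite !exprS !natrM.
field.
by rewrite c0 ?(nat1r, =^~ natrM) pnatr_eq0.
Qed.

Lemma staircase_coefS0 (n : nat) : staircase_coef n.+1 0 = 0.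
Proof.
by rewrite /staircase_coef big_ord1 staircase_term_l0.
Qed.

(** Multiplying by l(l+1) raises n by one; write it as (j+1)(j+2) plus
    (l - j - 1)(l + j + 2). The second product cancels one factor in each of
    the two factorials of the denominator, which turns j + 1 into j and drops
    the term l = j + 1. *)
Lemma staircase_coefSS (n j : nat) :
  staircase_coef n.+1 j.+1 =
    - (j.+1 * j.+2)%N%:R * staircase_coef n j.+1
    + (j.+1 ^ 2)%N%:R * staircase_coef n j.
Proof.
rewrite /staircase_coef big_ord_recr [in X in _ * X + _]big_ord_recr /=.
rewrite mulrDr addrAC.
congr (_ + _); last first.
  rewrite /staircase_term addSn exprS expnS.
  have -> : (j.+1 ^ 2 + j.+1 = j.+1 * j.+2)%N by lia.
  by rewrite !natrM; ring.
rewrite !mulr_sumr -big_split; apply: eq_bigr => -[l lj] _ /=.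
have [d ->] : exists d, j = (l + d)%N by exists (j - l)%N; lia.
rewrite /staircase_term addSn exprS expnS.
have -> : ((l + d).+1 - l = d.+1)%N by lia.
have -> : ((l + d) - l = d)%N by lia.
have -> : (l + (l + d).+1 + 1 = (l + (l + d) + 1).+1)%N by lia.
rewrite !factS.
rewrite !natrM ?natrD -!natr1 ?natrD -?natr1 ?natrM.
field.
by rewrite !natr_fact_neq0 ?(natr1, =^~ natrD) !pnatr_eq0.
Qed.

Lemma staircase_coef_gt (n j : nat) : (n < j)%N -> staircase_coef n j = 0.
Proof.
elim: n j => [|n IH] [|j] // nj; first by rewrite staircase_coef0.
by rewrite staircase_coefSS !IH ?mulr0 ?addr0 // ltnW.
Qed.

(** Walks of length n + m from 0, cut after n steps at the position j:
    prefix_weight 0 m j.+1 is the weight of all m-step continuations, the index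
    u = j + 1 counting None in addition to the j colours. Moving the cut by one
    step does not change the total. *)
Lemma staircase_coef_prefix_weight (n m : nat) :
  \sum_(j < n.+1) staircase_coef n j * prefix_weight 0 m j.+1
  = prefix_weight 0 (n + m) 1.
Proof.
elim: n m => [|n IH] m; first by rewrite big_ord1 staircase_coef0 mul1r.
rewrite addSnnS -IH big_ord_recl staircase_coefS0 mul0r add0r.
pose stay j : rat :=
  - (j * j.+1)%N%:R * staircase_coef n j * prefix_weight 0 m j.+1.
pose move j : rat :=
  (j.+1 ^ 2)%N%:R * staircase_coef n j * prefix_weight 0 m j.+2.
transitivity (\sum_(j < n.+1) (stay j.+1 + move j)).
  apply: eq_bigr => j _.
  by rewrite staircase_coefSS mulrDl.
transitivity (\sum_(j < n.+1) (stay j + move j)).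
  (* the index shifts freely since stay vanishes at 0 and at n + 1 *)
  rewrite !big_split; congr (_ + _).
  have stay0 : stay 0%N = 0 by rewrite /stay mul0n oppr0 !mul0r.
  have stayS : stay n.+1 = 0 by rewrite /stay staircase_coef_gt // mulr0 mul0r.
  by rewrite [LHS]big_ord_recr [RHS]big_ord_recl /= stay0 stayS addr0 add0r.
apply: eq_bigr => j _; rewrite /stay /move /= natrX natrM -natr1; ring.
Qed.

Theorem corollary5p3 (r : nat) (hr : (1 <= r)%N) :
  (boolean_number (ferrers (staircase r)))%:R =
    \sum_(1 <= j < r.+1) \sum_(1 <= l < j.+1)
      (-1) ^+ (r + l) *
      (((2 * l + 1) * (l ^ 2 + l) ^ r * j`! * j`!)%N%:R /
       ((l + j + 1)`! * (j - l)`!)%N%:R) :> rat.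
Proof.
transitivity (prefix_weight 0 r 1 : rat).
  rewrite -[LHS](rmorph_nat (intmul 1)) boolean_number_staircase.
  by rewrite rmorph_prefix_weight rmorph0.
rewrite -[in LHS](addn0 r) -staircase_coef_prefix_weight.
case: r hr => // r _.
rewrite big_ord_recl staircase_coefS0 mul0r add0r [RHS]big_add1 big_mkord.
apply: eq_bigr => j _.
rewrite mulr1 /staircase_coef big_ord_recl [RHS]big_add1 big_mkord.
by rewrite staircase_term_l0 add0r.
Qed.
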